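(* For every expression $e$ of the untyped $\lambda$-calculus with integers and arithmetic (i.e. built from integers, variables, arithmetic operations, abstraction and application) and every natural number $k$, $e\simeq\mathcal{O}[\![e]\!]k$, i.e. $e$ and its optimized version $\mathcal{O}[\![e]\!]k$ are contextually equivalent.
   Context: **Expressions.** $e ::= n \mid e\oplus e \mid x \mid \lambda x.\,e \mid e\;e \mid \mathbf{if}\,e\,\mathbf{then}\,e\,\mathbf{else}\,e$, with $n\in\mathbb{Z}$, $x$ a variable, and $\oplus\in\{+,\times,-,\ldots\}$ a total binary integer operation. Syntactic values: $\overline{v} ::= n\mid\lambda x.e$ with $\lambda x.e$ closed. $e[\overline{v}/x]$ is substitution for free occurrences of $x$. **Optimizer.** For $e$ without conditionals and $k\in\mathbb{N}$, $\mathcal{O}[\![e]\!]k$ is the expression defined by (recursion terminates by the lexicographic order on $k$, then the size of $e$): - $\mathcal{O}[\![x]\!]k=x$; $\mathcal{O}[\![n]\!]k=n$; $\mathcal{O}[\![\lambda x.e]\!]k=\lambda x.\,\mathcal{O}[\![e]\!]k$; - $\mathcal{O}[\![e_1\oplus e_2]\!]k=$ the integer $n_1\oplus n_2$ if $\mathcal{O}[\![e_1]\!]k=n_1$ and $\mathcal{O}[\![e_2]\!]k=n_2$ are integers; otherwise the expression $\mathcal{O}[\![e_1]\!]k\oplus\mathcal{O}[\![e_2]\!]k$; - $\mathcal{O}[\![e_1\,e_2]\!]k=\mathcal{O}[\![e[v_2/x]]\!](k-1)$ if $k\ge1$, $\mathcal{O}[\![e_1]\!]k=\lambda x.e$ and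 $\mathcal{O}[\![e_2]\!]k=v_2$ is a syntactic value; otherwise the expression $(\mathcal{O}[\![e_1]\!]k)\;(\mathcal{O}[\![e_2]\!]k)$. **Reduction.** $\longrightarrow$ is the standard call-by-value left-to-right reduction: $(\lambda x.e)\,\overline{v}\longrightarrow e[\overline{v}/x]$; $n_1\oplus n_2\longrightarrow n$ where $n$ is the integer $n_1\oplus n_2$; $\mathbf{if}\,n\,\mathbf{then}\,e_2\,\mathbf{else}\,e_3\longrightarrow e_2$ if $n\neq0$ and $\longrightarrow e_3$ if $n=0$; and congruence: if $e_1\longrightarrow e_1'$ then $e_1\,e_2\longrightarrow e_1'\,e_2$, $e_1\oplus e_2\longrightarrow e_1'\oplus e_2$, $\mathbf{if}\,e_1\,\mathbf{then}\,e_2\,\mathbf{else}\,e_3\longrightarrow\mathbf{if}\,e_1'\,\mathbf{then}\,e_2\,\mathbf{else}\,e_3$; if $e_2\longrightarrow e_2'$ then $\overline{v}\,e_2\longrightarrow\overline{v}\,e_2'$ and $\overline{v}\oplus e_2\longrightarrow\overline{v}\oplus e_2'$. For closed $e$, $e\Downarrow$ means $e\longrightarrow^*\overline{v}$ for some syntactic value $\overline{v}$. **Contextual equivalence.** Contexts: $C ::= \square\mid C\oplus e\mid e\oplus C\mid\lambda x.C\mid C\,e\mid e\,C$; $C[e]$ is (possibly capturing) replacement of the hole by $e$. $e\simeq e'$ means: for all $C$ with $FV(C[e])=FV(C[e'])=\emptyset$, $C[e]\Downarrow$ iff $C[e']\Downarrow$. *)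

(* Defs.v *)
From Stdlib Require Import ZArith List Relations.
Import ListNotations.
Set Implicit Arguments.

Definition var := nat.

(* The operators +, *, - together with an arbitrary family [X] of further
   ones, interpreted by total functions through [ext]. *)
Inductive binop (X : Type) : Type :=
| Add
| Mul
| Sub
| Ext (o : X).

Definition denote_op (X : Type) (ext : X -> Z -> Z -> Z) (o : binop X)
    (n m : Z) : Z :=
  match o with
  | Add _ => (n + m)%Z
  | Mul _ => (n * m)%Z
  | Sub _ => (n - m)%Z
  | Ext o' => ext o' n m
  end.

(* Raw named syntax, without quotient by alpha-conversion: only closed values
   are ever substituted, so no bound variable needs to be renamed. *)
Inductive expr (X : Type) : Type :=
| Int (n : Z)
| Op (o : binop X) (e1 e2 : expr X)
| Var (x : var)
| Lam (x : var) (e : expr X)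
| App (e1 e2 : expr X)
| If (e1 e2 e3 : expr X).

Arguments Int {X} n.
Arguments Var {X} x.

Fixpoint cond_free (X : Type) (e : expr X) : Prop :=
  match e with
  | Int _ | Var _ => True
  | Lam _ e1 => cond_free e1
  | Op _ e1 e2 | App e1 e2 => cond_free e1 /\ cond_free e2
  | If _ _ _ => False
  end.

Fixpoint fv (X : Type) (e : expr X) : list var :=
  match e with
  | Int _ => []
  | Var x => [x]
  | Lam x e1 => remove Nat.eq_dec x (fv e1)
  | Op _ e1 e2 | App e1 e2 => fv e1 ++ fv e2
  | If e1 e2 e3 => fv e1 ++ fv e2 ++ fv e3
  end.

Definition closed (X : Type) (e : expr X) : Prop := fv e = [].

Definition is_value (X : Type) (e : expr X) : bool :=
  match e with
  | Int _ => true
  | Lam _ _ => match fv e with [] => true | _ :: _ => false end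
  | _ => false
  end.

(* [subst x v e] is e[v/x]; it is only meaningful for closed [v], since
   nothing prevents capture. *)
Fixpoint subst (X : Type) (x : var) (v e : expr X) : expr X :=
  match e with
  | Int n => Int n
  | Var y => if Nat.eqb x y then v else Var y
  | Lam y e1 => if Nat.eqb x y then Lam y e1 else Lam y (subst x v e1)
  | Op o e1 e2 => Op o (subst x v e1) (subst x v e2)
  | App e1 e2 => App (subst x v e1) (subst x v e2)
  | If e1 e2 e3 => If (subst x v e1) (subst x v e2) (subst x v e3)
  end.

(* [opt ext k e] is O[[e]]k. It is specified on conditional-free expressions
   only; conditionals are returned unchanged, as a junk value. *)
Fixpoint opt (X : Type) (ext : X -> Z -> Z -> Z) (k : nat) {struct k} :
    expr X -> expr X :=
  fix opt_k (e : expr X) : expr X :=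
    match e with
    | Var x => Var x
    | Int n => Int n
    | Lam x e1 => Lam x (opt_k e1)
    | Op o e1 e2 =>
        match opt_k e1, opt_k e2 with
        | Int n1, Int n2 => Int (denote_op ext o n1 n2)
        | e1', e2' => Op o e1' e2'
        end
    | App e1 e2 =>
        match k, opt_k e1 with
        | S k', Lam x b =>
            if is_value (opt_k e2) then opt ext k' (subst x (opt_k e2) b)
            else App (Lam x b) (opt_k e2)
        | _, e1' => App e1' (opt_k e2)
        end
    | If _ _ _ => e
    end.

Inductive step (X : Type) (ext : X -> Z -> Z -> Z) :
    expr X -> expr X -> Prop :=
| step_beta x e v :
    is_value v = true ->
    step ext (App (Lam x e) v) (subst x v e)
| step_op o n1 n2 :
    step ext (Op o (Int n1) (Int n2)) (Int (denote_op ext o n1 n2))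
| step_if_true n e2 e3 :
    n <> 0%Z -> step ext (If (Int n) e2 e3) e2
| step_if_false e2 e3 :
    step ext (If (Int 0%Z) e2 e3) e3
| step_app_l e1 e1' e2 :
    step ext e1 e1' -> step ext (App e1 e2) (App e1' e2)
| step_op_l o e1 e1' e2 :
    step ext e1 e1' -> step ext (Op o e1 e2) (Op o e1' e2)
| step_if e1 e1' e2 e3 :
    step ext e1 e1' -> step ext (If e1 e2 e3) (If e1' e2 e3)
| step_app_r v e2 e2' :
    is_value v = true ->
    step ext e2 e2' -> step ext (App v e2) (App v e2')
| step_op_r o v e2 e2' :
    is_value v = true ->
    step ext e2 e2' -> step ext (Op o v e2) (Op o v e2').

Definition terminates (X : Type) (ext : X -> Z -> Z -> Z) (e : expr X) : Prop :=
  exists v : expr X, is_value v = true /\ clos_refl_trans _ (step ext) e v.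

(* The hole never occurs inside a conditional, but the expressions surrounding
   it are arbitrary and may contain some. *)
Inductive ctx (X : Type) : Type :=
| Hole
| COpL (o : binop X) (C : ctx X) (e : expr X)
| COpR (o : binop X) (e : expr X) (C : ctx X)
| CLam (x : var) (C : ctx X)
| CAppL (C : ctx X) (e : expr X)
| CAppR (e : expr X) (C : ctx X).

Fixpoint fill (X : Type) (C : ctx X) (e : expr X) : expr X :=
  match C with
  | Hole _ => e
  | COpL o C1 e2 => Op o (fill C1 e) e2
  | COpR o e1 C2 => Op o e1 (fill C2 e)
  | CLam x C1 => Lam x (fill C1 e)
  | CAppL C1 e2 => App (fill C1 e) e2
  | CAppR e1 C2 => App e1 (fill C2 e)
  end.

Definition ctx_equiv (X : Type) (ext : X -> Z -> Z -> Z) (e e' : expr X) : Prop :=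
  forall C : ctx X,
    closed (fill C e) -> closed (fill C e') ->
    (terminates ext (fill C e) <-> terminates ext (fill C e')).

(* Main.v *)
Require Import Defs.
From Stdlib Require Import ZArith List Relations.

(** The optimizer only contracts redexes [(\x.b) v] and [n1 op n2], possibly
    under binders, so every expression reaches its optimized form by a sequence
    of parallel reductions. Parallel reduction is closed under contexts, and it
    is a simulation for big-step evaluation in both directions. Its rules for
    redexes are in expansion form (the contractum goes on being related to the
    right-hand side): this makes the backward simulation go through by
    induction on the evaluation of the right-hand side, with no measure on the
    size of the parallel reduction. *)

(** * Free variables and substitution of closed expressions *)

Lemma in_remove_iff (x y : var) (l : list var) :
  In y (remove Nat.eq_dec x l) <-> In y l /\ y <> x.
Proof.
  split.
  - apply in_remove.
  - intros [Hin Hne]. now apply in_in_remove.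
Qed.

Lemma closed_not_in {X : Type} (e : expr X) :
  closed e <-> forall x, ~ In x (fv e).
Proof.
  unfold closed. split.
  - intros -> x [].
  - intros H. destruct (fv e) as [|x l]; [reflexivity|].
    destruct (H x). now left.
Qed.

Lemma value_closed {X : Type} (v : expr X) : is_value v = true -> closed v.
Proof.
  unfold closed. destruct v; simpl; try discriminate; trivial.
  now destruct (remove _ _ _).
Qed.

Lemma closed_lam_value {X : Type} (x : var) (e : expr X) :
  closed (Lam x e) -> is_value (Lam x e) = true.
Proof. unfold closed. simpl. now intros ->. Qed.

Lemma fv_subst {X : Type} (x y : var) (v e : expr X) (hv : closed v) :
  In y (fv (subst x v e)) <-> In y (fv e) /\ y <> x.
Proof.
  induction e as [n|o e1 IH1 e2 IH2|z|z e1 IH|e1 IH1 e2 IH2|e1 IH1 e2 IH2 e3 IH3];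
    simpl; rewrite ?in_app_iff; try tauto.
  - destruct (Nat.eqb_spec x z) as [<-|Hne]; simpl.
    + rewrite hv. simpl. intuition congruence.
    + intuition congruence.
  - destruct (Nat.eqb_spec x z) as [<-|Hne]; simpl; rewrite !in_remove_iff; tauto.
Qed.

Lemma subst_not_free {X : Type} (x : var) (v e : expr X) :
  ~ In x (fv e) -> subst x v e = e.
Proof.
  induction e as [n|o e1 IH1 e2 IH2|z|z e1 IH|e1 IH1 e2 IH2|e1 IH1 e2 IH2 e3 IH3];
    simpl; rewrite ?in_app_iff; intros H.
  - reflexivity.
  - rewrite IH1, IH2; tauto.
  - destruct (Nat.eqb_spec x z) as [<-|]; [tauto|reflexivity].
  - destruct (Nat.eqb_spec x z) as [<-|Hne]; [reflexivity|].
    rewrite IH; [reflexivity|]. rewrite in_remove_iff in H. tauto.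
  - rewrite IH1, IH2; tauto.
  - rewrite IH1, IH2, IH3; tauto.
Qed.

Lemma subst_closed {X : Type} (x : var) (v e : expr X) :
  closed e -> subst x v e = e.
Proof. intros H. apply subst_not_free. now apply closed_not_in. Qed.

Lemma subst_subst_same {X : Type} (x : var) (v w e : expr X) (hw : closed w) :
  subst x v (subst x w e) = subst x w e.
Proof. apply subst_not_free. rewrite fv_subst by assumption. tauto. Qed.

Lemma subst_comm {X : Type} (x y : var) (v w e : expr X)
  (hxy : x <> y) (hv : closed v) (hw : closed w) :
  subst x v (subst y w e) = subst y w (subst x v e).
Proof.
  induction e as [n|o e1 IH1 e2 IH2|z|z e1 IH|e1 IH1 e2 IH2|e1 IH1 e2 IH2 e3 IH3];
    simpl; try congruence.
  - destruct (Nat.eqb y z) eqn:Hy, (Nat.eqb x z) eqn:Hx; simpl; rewrite ?Hy, ?Hx;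
      rewrite ?subst_closed by assumption; try reflexivity.
    apply Nat.eqb_eq in Hy, Hx. congruence.
  - destruct (Nat.eqb y z) eqn:Hy, (Nat.eqb x z) eqn:Hx; simpl;
      rewrite Hy, Hx; congruence.
Qed.

Section Reduction.

Variables (X : Type) (ext : X -> Z -> Z -> Z).

(** * Big-step evaluation and its agreement with small-step reduction *)

Inductive eval : expr X -> expr X -> Prop :=
| eval_value v : is_value v = true -> eval v v
| eval_op o e1 e2 n1 n2 :
    eval e1 (Int n1) -> eval e2 (Int n2) ->
    eval (Op o e1 e2) (Int (denote_op ext o n1 n2))
| eval_app e1 e2 x b v w :
    eval e1 (Lam x b) -> eval e2 v -> eval (subst x v b) w ->
    eval (App e1 e2) w
| eval_if_true e1 e2 e3 n w :
    eval e1 (Int n) -> n <> 0%Z -> eval e2 w -> eval (If e1 e2 e3) w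
| eval_if_false e1 e2 e3 w :
    eval e1 (Int 0%Z) -> eval e3 w -> eval (If e1 e2 e3) w.

Lemma eval_is_value (e v : expr X) : eval e v -> is_value v = true.
Proof. induction 1; auto. Qed.

Lemma eval_value_inv (v w : expr X) : is_value v = true -> eval v w -> w = v.
Proof. intros Hv Hw. destruct Hw; auto; discriminate. Qed.

Lemma clos_rt_map (R : relation (expr X)) (f : expr X -> expr X)
  (hf : forall a b, R a b -> R (f a) (f b)) (a b : expr X) :
  clos_refl_trans _ R a b -> clos_refl_trans _ R (f a) (f b).
Proof.
  induction 1 as [a b H| |a b c _ IH1 _ IH2].
  - apply rt_step. auto.
  - apply rt_refl.
  - exact (rt_trans _ _ _ _ _ IH1 IH2).
Qed.

Lemma eval_steps (e v : expr X) :
  eval e v -> clos_refl_trans _ (step ext) e v.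
Proof.
  induction 1 as [v Hv|o e1 e2 n1 n2 H1 IH1 H2 IH2|e1 e2 x b v w H1 IH1 H2 IH2 H3 IH3
                 |e1 e2 e3 n w H1 IH1 Hn H2 IH2|e1 e2 e3 w H1 IH1 H2 IH2].
  - apply rt_refl.
  - apply rt_trans with (Op o (Int n1) e2).
    { apply (clos_rt_map (step ext) (fun e => Op o e e2)); [|assumption].
      intros; now apply step_op_l. }
    apply rt_trans with (Op o (Int n1) (Int n2)).
    { apply (clos_rt_map (step ext) (Op o (Int n1))); [|assumption].
      intros; now apply step_op_r. }
    apply rt_step, step_op.
  - apply rt_trans with (App (Lam x b) e2).
    { apply (clos_rt_map (step ext) (fun e => App e e2)); [|assumption].
      intros; now apply step_app_l. }
    apply rt_trans with (App (Lam x b) v).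
    { apply (clos_rt_map (step ext) (App (Lam x b))); [|assumption].
      intros; apply step_app_r; [|assumption]. exact (eval_is_value _ _ H1). }
    apply rt_trans with (subst x v b); [|assumption].
    apply rt_step, step_beta. exact (eval_is_value _ _ H2).
  - apply rt_trans with (If (Int n) e2 e3).
    { apply (clos_rt_map (step ext) (fun e => If e e2 e3)); [|assumption].
      intros; now apply step_if. }
    apply rt_trans with e2; [|assumption]. now apply rt_step, step_if_true.
  - apply rt_trans with (If (Int 0) e2 e3).
    { apply (clos_rt_map (step ext) (fun e => If e e2 e3)); [|assumption].
      intros; now apply step_if. }
    apply rt_trans with e3; [|assumption]. apply rt_step, step_if_false.
Qed.

Lemma step_fv (e e' : expr X) (y : var) :
  step ext e e' -> In y (fv e') -> In y (fv e).
Proof.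
  induction 1; simpl in *; rewrite ?in_app_iff; try tauto.
  rewrite fv_subst by now apply value_closed.
  rewrite in_remove_iff. tauto.
Qed.

Lemma step_closed (e e' : expr X) : step ext e e' -> closed e -> closed e'.
Proof.
  rewrite !closed_not_in. intros Hs Hc y Hy. exact (Hc y (step_fv _ _ _ Hs Hy)).
Qed.

Lemma closed_op (o : binop X) (e1 e2 : expr X) :
  closed (Op o e1 e2) -> closed e1 /\ closed e2.
Proof. apply app_eq_nil. Qed.

Lemma closed_app (e1 e2 : expr X) :
  closed (App e1 e2) -> closed e1 /\ closed e2.
Proof. apply app_eq_nil. Qed.

Lemma closed_if (e1 e2 e3 : expr X) :
  closed (If e1 e2 e3) -> closed e1 /\ closed e2 /\ closed e3.
Proof.
  intros H. apply app_eq_nil in H as [H1 H]. split; [exact H1|].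
  now apply app_eq_nil in H.
Qed.

Lemma closed_beta (x : var) (b v : expr X) :
  closed (Lam x b) -> closed v -> closed (subst x v b).
Proof.
  rewrite (closed_not_in (Lam x b)), (closed_not_in (subst x v b)).
  intros Hb Hv y. rewrite fv_subst by assumption.
  specialize (Hb y). simpl in Hb. now rewrite in_remove_iff in Hb.
Qed.

(** A small step is absorbed at the front of an evaluation: a congruence step changes one premise of
    the last rule, and a redex step supplies a rule whose other premises are values. Closedness
    enters at a beta redex, where it makes the abstraction a value that evaluates to itself. *)
Lemma step_eval (e e' : expr X) :
  step ext e e' -> closed e -> forall v, eval e' v -> eval e v.
Proof.
  induction 1 as [x b u Hu|o n1 n2|n e2 e3 Hn|e2 e3
                 |e1 e1' e2 _ IH|o e1 e1' e2 _ IH|e1 e1' e2 e3 _ IH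
                 |u e2 e2' Hu _ IH|o u e2 e2' Hu _ IH]; intros Hc v Hv.
  - apply closed_app in Hc as [Hc _].
    apply eval_app with x b u; [| |assumption]; apply eval_value; [|assumption].
    now apply closed_lam_value.
  - apply eval_value_inv in Hv; [subst|reflexivity].
    apply eval_op; now apply eval_value.
  - apply eval_if_true with n; auto. now apply eval_value.
  - apply eval_if_false; auto. now apply eval_value.
  - apply closed_app in Hc as [Hc1 Hc2].
    inversion Hv; subst; [discriminate|]. eapply eval_app; eauto.
  - apply closed_op in Hc as [Hc1 Hc2].
    inversion Hv; subst; [discriminate|]. eapply eval_op; eauto.
  - apply closed_if in Hc as [Hc1 [Hc2 Hc3]].
    inversion Hv; subst; [discriminate| |].
    + eapply eval_if_true; eauto.
    + eapply eval_if_false; eauto.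
  - apply closed_app in Hc as [Hc1 Hc2].
    inversion Hv; subst; [discriminate|]. eapply eval_app; eauto.
  - apply closed_op in Hc as [Hc1 Hc2].
    inversion Hv; subst; [discriminate|]. eapply eval_op; eauto.
Qed.

(** This turns termination into the existence of a derivation, on which the simulations can proceed
    by induction. From left to right, the reduction sequence is absorbed backwards from its final
    value by [step_eval]. *)
Lemma terminates_iff_eval (e : expr X) :
  closed e -> terminates ext e <-> exists v, eval e v.
Proof.
  intros Hc. split.
  - intros [v [Hv Hs]]. exists v.
    apply clos_rt_rt1n in Hs.
    induction Hs as [v|e e' v Hs _ IH]; [now apply eval_value|].
    apply (step_eval _ _ Hs Hc), IH; [|assumption]. exact (step_closed _ _ Hs Hc).
  - intros [v Hv]. exists v. split; [exact (eval_is_value _ _ Hv)|].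
    now apply eval_steps.
Qed.

(** * Parallel reduction: free variables, substitution and values *)

Inductive par : expr X -> expr X -> Prop :=
| par_int n : par (Int n) (Int n)
| par_var x : par (Var x) (Var x)
| par_lam x e e' : par e e' -> par (Lam x e) (Lam x e')
| par_op o e1 e1' e2 e2' :
    par e1 e1' -> par e2 e2' -> par (Op o e1 e2) (Op o e1' e2')
| par_app e1 e1' e2 e2' :
    par e1 e1' -> par e2 e2' -> par (App e1 e2) (App e1' e2')
| par_if e1 e1' e2 e2' e3 e3' :
    par e1 e1' -> par e2 e2' -> par e3 e3' -> par (If e1 e2 e3) (If e1' e2' e3')
| par_beta x b v e' :
    is_value v = true -> par (subst x v b) e' -> par (App (Lam x b) v) e'
| par_delta o n1 n2 :
    par (Op o (Int n1) (Int n2)) (Int (denote_op ext o n1 n2)).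

Lemma par_refl (e : expr X) : par e e.
Proof. induction e; constructor; assumption. Qed.

(** Reduction usually may lose free variables, when an argument is discarded. Here [par_beta] only
    fires on a value, which is closed, so nothing is lost. Closedness therefore transfers in both
    directions. *)
Lemma par_fv (e e' : expr X) (y : var) :
  par e e' -> In y (fv e) <-> In y (fv e').
Proof.
  induction 1 as [| | | | | |x b v e' Hv _ IH|]; simpl;
    rewrite ?in_app_iff, ?in_remove_iff; try tauto.
  rewrite <- IH, fv_subst, (value_closed _ Hv); [|now apply value_closed].
  simpl. tauto.
Qed.

Lemma par_closed (e e' : expr X) : par e e' -> closed e <-> closed e'.
Proof.
  rewrite !closed_not_in. intros H.
  split; intros Hc y; [rewrite <- (par_fv _ _ y H)|rewrite (par_fv _ _ y H)]; auto.
Qed.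

Lemma par_subst (x : var) (v v' e e' : expr X)
  (hv : closed v) (hv' : closed v') (hvv : par v v') :
  par e e' -> par (subst x v e) (subst x v' e').
Proof.
  induction 1 as [| y |y| | | |y b w e' Hw _ IH|]; simpl;
    try (constructor; assumption).
  - destruct (Nat.eqb x y); [assumption|constructor].
  - destruct (Nat.eqb x y); constructor; assumption.
  (* The argument [w] is closed, so the substitution leaves it unchanged and the redex remains a
     redex. If [x] is the bound variable, the substitution stops at the binder and [x] is absent
     from the contractum; otherwise the two substitutions commute. *)
  - assert (Hc := value_closed _ Hw).
    rewrite (subst_closed x v w Hc).
    destruct (Nat.eqb_spec x y) as [<-|Hne]; apply par_beta; try assumption.
    + now rewrite subst_subst_same in IH.
    + now rewrite subst_comm in IH.
Qed.

Lemma par_value (v v' : expr X) :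
  is_value v = true -> par v v' -> is_value v' = true.
Proof.
  intros Hv Hp. assert (Hc := proj1 (par_closed _ _ Hp) (value_closed _ Hv)).
  destruct Hp; try discriminate; [reflexivity|]. now apply closed_lam_value.
Qed.

(** * Simulation of evaluation along parallel reduction, forward and backward *)

Lemma eval_par (e v : expr X) :
  eval e v -> forall e', par e e' -> exists v', eval e' v' /\ par v v'.
Proof.
  induction 1 as [v Hv|o e1 e2 n1 n2 H1 IH1 H2 IH2|e1 e2 x b v w H1 IH1 H2 IH2 H3 IH3
                 |e1 e2 e3 n w H1 IH1 Hn H2 IH2|e1 e2 e3 w H1 IH1 H2 IH2];
    intros e' Hp.
  - exists e'. split; [|assumption]. apply eval_value. exact (par_value _ _ Hv Hp).
  - inversion Hp; subst.
    + destruct (IH1 _ ltac:(eassumption)) as [v1 [Hv1 Hp1]]; inversion Hp1; subst.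
      destruct (IH2 _ ltac:(eassumption)) as [v2 [Hv2 Hp2]]; inversion Hp2; subst.
      eexists. split; [apply eval_op; eassumption|apply par_int].
    + apply eval_value_inv in H1, H2; try reflexivity. injection H1 as ->.
      injection H2 as ->. eexists. split; [now apply eval_value|apply par_int].
  - inversion Hp as [| | | |? e1' ? e2' Hp1 Hp2| |y c u e'' Hu Hp'|]; subst.
    + destruct (IH1 _ Hp1) as [f [Hf Hpf]].
      inversion Hpf as [| |? ? b' Hb| | | | |]; subst.
      destruct (IH2 _ Hp2) as [v' [Hv' Hpv]].
      destruct (IH3 (subst x v' b')) as [w' [Hw' Hpw]].
      { apply par_subst; try assumption; eapply value_closed, eval_is_value; eassumption. }
      exists w'. split; [|assumption]. now apply eval_app with x b' v'.
    (* In the [par_beta] case the function is already an abstraction and the argument already a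
       value. Both evaluate to themselves, so the third premise evaluates exactly the contractum
       that [Hp'] relates to [e']. *)
    + apply eval_value_inv in H2; [subst v|assumption].
      assert (Heq : Lam x b = Lam y c) by (inversion H1; reflexivity).
      injection Heq as -> ->. exact (IH3 _ Hp').
  - inversion Hp; subst.
    destruct (IH1 _ ltac:(eassumption)) as [v1 [Hv1 Hp1]]; inversion Hp1; subst.
    destruct (IH2 _ ltac:(eassumption)) as [w' [Hw' Hpw]].
    exists w'. split; [|assumption]. now apply eval_if_true with n.
  - inversion Hp; subst.
    destruct (IH1 _ ltac:(eassumption)) as [v1 [Hv1 Hp1]]; inversion Hp1; subst.
    destruct (IH2 _ ltac:(eassumption)) as [w' [Hw' Hpw]].
    exists w'. split; [|assumption]. now apply eval_if_false.
Qed.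

Lemma par_value_inv (v v' : expr X) (hv : is_value v = true) :
  par v v' ->
  match v' with
  | Int n => v = Int n
  | Lam x b' => exists b, v = Lam x b /\ par b b'
  | _ => False
  end.
Proof. destruct 1; try discriminate; eauto. Qed.

(** The induction on the evaluation of the right-hand side contains, in each case, an induction on
    [par]. The latter peels off the [par_beta] rules at the root, which leave the right-hand side
    fixed, until a congruence or [par_delta] exposes its shape; only then are the outer induction
    hypotheses used. *)
Lemma par_eval (e' v' : expr X) :
  eval e' v' ->
  forall e, closed e -> par e e' -> exists v, eval e v /\ par v v'.
Proof.
  (* The peeling step: a result found for the contractum is also one for the redex. It closes the
     [par_beta] case of each inner induction. *)
  assert (Hbeta : forall x b u w, closed (App (Lam x b) u) -> is_value u = true ->
            (closed (subst x u b) -> exists v, eval (subst x u b) v /\ par v w) ->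
            exists v, eval (App (Lam x b) u) v /\ par v w).
  { intros x b u w Hc Hu H. apply closed_app in Hc as [Hc1 Hc2].
    destruct (H (closed_beta _ _ _ Hc1 Hc2)) as [v [Hv Hp]].
    exists v. split; [|assumption].
    apply eval_app with x b u; [| |assumption]; apply eval_value; [|assumption].
    now apply closed_lam_value. }
  induction 1 as [v Hv|o e1 e2 n1 n2 H1 IH1 H2 IH2|e1 e2 x b v w H1 IH1 H2 IH2 H3 IH3
                 |e1 e2 e3 n w H1 IH1 Hn H2 IH2|e1 e2 e3 w H1 IH1 H2 IH2];
    intros e Hc Hp.
  - induction Hp as [n|x|x e e' Hp _|o f1 f1' f2 f2'|f1 f1' f2 f2'|f1 f1' f2 f2' f3 f3'
                    |x b u e' Hu _ IH|o n1 n2]; try discriminate.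
    + eexists. split; [now apply eval_value|apply par_int].
    + eexists. split; [|apply par_lam; eassumption].
      now apply eval_value, closed_lam_value.
    + auto.
    (* The right-hand side is an integer produced by [par_delta]; the left-hand side is an operation
       still to be evaluated. *)
    + eexists. split; [|apply par_int]. apply eval_op; now apply eval_value.
  - remember (Op o e1 e2) as e' eqn:He'.
    induction Hp as [n|x|x e e' Hp _|o' f1 f1' f2 f2' Hp1 _ Hp2 _|f1 f1' f2 f2'|
                    |x b u e' Hu _ IH|]; try discriminate; auto.
    injection He' as -> -> ->. apply closed_op in Hc as [Hc1 Hc2].
    destruct (IH1 _ Hc1 Hp1) as [v1 [Hv1 Hq1]].
    destruct (IH2 _ Hc2 Hp2) as [v2 [Hv2 Hq2]].
    apply par_value_inv in Hq1, Hq2; try (eapply eval_is_value; eassumption). subst.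
    eexists. split; [apply eval_op; eassumption|apply par_int].
  - remember (App e1 e2) as e' eqn:He'.
    induction Hp as [n|y|y e e' Hp _|o' f1 f1' f2 f2'|f1 f1' f2 f2' Hp1 _ Hp2 _|
                    |y c u e' Hu _ IH|]; try discriminate; auto.
    injection He' as -> ->. apply closed_app in Hc as [Hc1 Hc2].
    destruct (IH1 _ Hc1 Hp1) as [f [Hf Hq1]].
    destruct (IH2 _ Hc2 Hp2) as [u [Hu Hq2]].
    apply par_value_inv in Hq1; [|eapply eval_is_value; eassumption].
    destruct Hq1 as [c [-> Hcb]].
    apply eval_is_value, value_closed in H2.
    assert (Hcu := value_closed _ (eval_is_value _ _ Hu)).
    (* The left-hand function and argument evaluate to [Lam x c] and [u], related to [Lam x b] and
       [v]. Hence [par_subst] relates the two contracta, and the hypothesis on the evaluation of the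
       body applies. *)
    destruct (IH3 (subst x u c)) as [w' [Hw' Hpw]].
    { apply closed_beta; [|assumption]. eapply value_closed, eval_is_value; eassumption. }
    { now apply par_subst. }
    exists w'. split; [|assumption]. now apply eval_app with x c u.
  - remember (If e1 e2 e3) as e' eqn:He'.
    induction Hp as [| | | | |f1 f1' f2 f2' f3 f3' Hp1 _ Hp2 _ Hp3 _
                    |y c u e' Hu _ IH|]; try discriminate; auto.
    injection He' as -> -> ->. apply closed_if in Hc as [Hc1 [Hc2 Hc3]].
    destruct (IH1 _ Hc1 Hp1) as [v1 [Hv1 Hq1]].
    apply par_value_inv in Hq1; [subst|eapply eval_is_value; eassumption].
    destruct (IH2 _ Hc2 Hp2) as [w' [Hw' Hpw]].
    exists w'. split; [|assumption]. now apply eval_if_true with n.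
  - remember (If e1 e2 e3) as e' eqn:He'.
    induction Hp as [| | | | |f1 f1' f2 f2' f3 f3' Hp1 _ Hp2 _ Hp3 _
                    |y c u e' Hu _ IH|]; try discriminate; auto.
    injection He' as -> -> ->. apply closed_if in Hc as [Hc1 [Hc2 Hc3]].
    destruct (IH1 _ Hc1 Hp1) as [v1 [Hv1 Hq1]].
    apply par_value_inv in Hq1; [subst|eapply eval_is_value; eassumption].
    destruct (IH2 _ Hc3 Hp3) as [w' [Hw' Hpw]].
    exists w'. split; [|assumption]. now apply eval_if_false.
Qed.

(** * From parallel reduction to contextual equivalence *)

Lemma par_terminates (e e' : expr X) :
  closed e -> par e e' -> terminates ext e <-> terminates ext e'.
Proof.
  intros Hc Hp. assert (Hc' := proj1 (par_closed _ _ Hp) Hc).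
  rewrite !terminates_iff_eval by assumption. split; intros [v Hv].
  - destruct (eval_par _ _ Hv _ Hp) as [v' [Hv' _]]. eauto.
  - destruct (par_eval _ _ Hv _ Hc Hp) as [v' [Hv' _]]. eauto.
Qed.

Lemma par_fill (C : ctx X) (e e' : expr X) :
  par e e' -> par (fill C e) (fill C e').
Proof.
  intros Hp. induction C; simpl; try constructor; auto using par_refl.
Qed.

(** One [par] step does not suffice: a redex whose function becomes an abstraction only after its
    subterm is reduced has to wait for a later step. *)
Definition pars := clos_refl_trans (expr X) par.

Lemma pars_ctx_equiv (e e' : expr X) : pars e e' -> ctx_equiv ext e e'.
Proof.
  (* The whole chain is moved inside the context before termination is compared link by link;
     [par_closed] keeps every intermediate program closed. *)
  intros Hp C Hc _. apply (clos_rt_map par (fill C) (par_fill C)) in Hp.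
  apply clos_rt_rt1n in Hp.
  induction Hp as [|a b c Hab _ IH]; [tauto|].
  rewrite (par_terminates _ _ Hc Hab). apply IH.
  now apply (par_closed _ _ Hab).
Qed.

Lemma pars_lam (x : var) (e e' : expr X) :
  pars e e' -> pars (Lam x e) (Lam x e').
Proof. apply (clos_rt_map par (Lam x)). intros. now apply par_lam. Qed.

Lemma pars_op (o : binop X) (e1 e1' e2 e2' : expr X) :
  pars e1 e1' -> pars e2 e2' -> pars (Op o e1 e2) (Op o e1' e2').
Proof.
  intros H1 H2. apply rt_trans with (Op o e1' e2).
  - apply (clos_rt_map par (fun e => Op o e e2)); [|assumption].
    intros; apply par_op; [assumption|apply par_refl].
  - apply (clos_rt_map par (Op o e1')); [|assumption].
    intros; apply par_op; [apply par_refl|assumption].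
Qed.

Lemma pars_app (e1 e1' e2 e2' : expr X) :
  pars e1 e1' -> pars e2 e2' -> pars (App e1 e2) (App e1' e2').
Proof.
  intros H1 H2. apply rt_trans with (App e1' e2).
  - apply (clos_rt_map par (fun e => App e e2)); [|assumption].
    intros; apply par_app; [assumption|apply par_refl].
  - apply (clos_rt_map par (App e1')); [|assumption].
    intros; apply par_app; [apply par_refl|assumption].
Qed.

(** * The optimizer as a sequence of parallel reductions *)

Lemma opt_op (k : nat) (o : binop X) (e1 e2 : expr X) :
  opt ext k (Op o e1 e2) =
  match opt ext k e1, opt ext k e2 with
  | Int n1, Int n2 => Int (denote_op ext o n1 n2)
  | e1', e2' => Op o e1' e2'
  end.
(* The outer fixpoint of [opt] is structural in [k], so it unfolds only once [k] is a
   constructor. *)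
Proof. now destruct k. Qed.

Lemma pars_opt_op (k : nat) (o : binop X) (e1 e2 : expr X) :
  pars (Op o (opt ext k e1) (opt ext k e2)) (opt ext k (Op o e1 e2)).
Proof.
  rewrite opt_op.
  destruct (opt ext k e1); try apply rt_refl.
  destruct (opt ext k e2); try apply rt_refl.
  apply rt_step, par_delta.
Qed.

(** The nested inductions follow the recursion of [opt]: the inner one on [e] treats subterms at the
    same [k], the outer one on [k] treats the contractum of a beta redex, which is not a subterm. *)
Lemma pars_opt (k : nat) (e : expr X) : pars e (opt ext k e).
Proof.
  revert e.
  induction k as [|k IHk]; intros e;
    induction e as [n|o e1 IH1 e2 IH2|z|z e1 IH1|e1 IH1 e2 IH2|e1 _ e2 _ e3 _];
    try apply rt_refl; try (apply pars_lam; assumption);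
    try (eapply rt_trans; [apply pars_op; eassumption|apply pars_opt_op]).
  - apply pars_app; assumption.
  - apply rt_trans with (App (opt ext (S k) e1) (opt ext (S k) e2)).
    { now apply pars_app. }
    (* One unfolding of [opt], with the recursive calls kept folded so that the case analyses and
       the outer hypothesis match them. *)
    change (opt ext (S k) (App e1 e2)) with
      (match opt ext (S k) e1 with
       | Lam x b =>
           if is_value (opt ext (S k) e2)
           then opt ext k (subst x (opt ext (S k) e2) b)
           else App (Lam x b) (opt ext (S k) e2)
       | e1' => App e1' (opt ext (S k) e2)
       end).
    destruct (opt ext (S k) e1) as [| | |x b| |]; try apply rt_refl.
    destruct (is_value (opt ext (S k) e2)) eqn:Hv; [|apply rt_refl].
    apply rt_trans with (subst x (opt ext (S k) e2) b); [|apply IHk].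
    apply rt_step, par_beta; [assumption|apply par_refl].
Qed.

End Reduction.

Theorem theorem5 (X : Type) (ext : X -> Z -> Z -> Z) (e : expr X) (k : nat)
  (he : cond_free e) :
  ctx_equiv ext e (opt ext k e).
Proof. apply pars_ctx_equiv, pars_opt. Qed.
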